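(* Let $r>0$ be an integer and let $C(r)$ be a constant such that every polynomial $Q:[0,1]\to[0,1]$ of degree $r$ satisfies $\|Q\|_r\le C(r)$. Then for any polynomial $P:[0,1]\to[0,1]$ of degree $r$ and any $0<\varepsilon<1$, $$h^*(P,\varepsilon)\le\frac{\log^+C(r)}{|\log\varepsilon|}.$$
   Context: $\|Q\|_r=\max_{1\le k\le r}\|Q^{(k)}\|_\infty$, with sup norms over $[0,1]$. Such a constant $C(r)$ exists for every $r$ by Markov's inequality. $\log^+x=\max(\log x,0)$. Tail entropy of a continuous map $f:[0,1]\to[0,1]$ (with $d(x,y)=|x-y|$): $B_n(f,x,\varepsilon)=\{y: d(f^iy,f^ix)<\varepsilon,\ 0\le i\le n-1\}$; $r_n(f,\Lambda,\delta)$ is the smallest cardinality of a set $K\subset[0,1]$ such that for every $x\in\Lambda$ there is $y\in K$ with $d(f^ix,f^iy)<\delta$ for $0\le i\le n-1$; and $$h^*(f,\varepsilon)=\lim_{\delta\to0}\limsup_{n\to\infty}\frac1n\log\sup_{x\in[0,1]} r_n(f,B_n(f,x,\varepsilon),\delta).$$ *)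

(* Defs.v *)
From HB Require Import structures.
From mathcomp Require Import all_boot all_order all_algebra.
From mathcomp Require Import finmap.
From mathcomp Require Import all_classical all_reals all_analysis.

Set Implicit Arguments.
Unset Strict Implicit.
Unset Printing Implicit Defensive.

Import Order.TTheory GRing.Theory Num.Theory.
Import numFieldNormedType.Exports.

Local Open Scope classical_set_scope.
Local Open Scope ring_scope.

Section Defs.
Context {R : realType}.
Implicit Types (f : R -> R) (x y eps delta : R) (n r : nat) (Q : {poly R}).

Definition unit_interval : set R := `[0, 1].

Definition unit_self_map f : Prop :=
  forall x, unit_interval x -> unit_interval (f x).

(* Recall that [size Q] is the degree plus one. *)
Definition poly_self_map r Q : Prop :=
  size Q = r.+1 /\ unit_self_map (fun x => Q.[x]).

(* The real [sup] is junk on unbounded sets; it is only applied to polynomial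
   functions, which are bounded on [0, 1]. *)
Definition sup_norm f : R := sup [set `|f x| | x in unit_interval].

Definition Cr_norm r Q : R :=
  \big[Num.max/0]_(1 <= k < r.+1) sup_norm (fun x => (Q^`(k)).[x]).

Definition log_plus x : R := Num.max (ln x) 0.

(* A self-map of [0, 1] is represented by a function on R, of which only the
   values on [0, 1] matter below. *)
Definition dyn_ball f n x eps : set R :=
  [set y | unit_interval y /\
    forall i, (i < n)%N -> `|iter i f y - iter i f x| < eps].

Definition spanning f n (L : set R) delta (K : {fset R}) : Prop :=
  [set` K] `<=` unit_interval /\
  forall x, L x -> exists2 y, y \in K &
    forall i, (i < n)%N -> `|iter i f x - iter i f y| < delta.

(* Smallest cardinality of a spanning set, with value +oo if no finite set is
   spanning. *)
Definition span_number f n (L : set R) delta : \bar R :=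
  ereal_inf [set ((#|` K|)%:R)%:E | K in spanning f n L delta].

Definition tail_growth f eps delta : \bar R :=
  limn_esup (fun n => (n%:R^-1)%:E *
    lne (ereal_sup [set span_number f n (dyn_ball f n x eps) delta
                   | x in unit_interval]))%E.

Definition tail_entropy f eps : \bar R :=
  lim (tail_growth f eps delta @[delta --> 0^'+]).

End Defs.

(* Main.v *)
Require Import Defs.
From mathcomp Require Import all_boot all_order all_algebra.
From mathcomp Require Import finmap polyrcf ring lra.
From mathcomp Require Import all_classical all_reals all_analysis.

Import Order.TTheory GRing.Theory Num.Theory.

Local Open Scope ring_scope.

(** Why the bound holds.  Fix x and let W_l be the part of [0, 1] within rho of
the l-th iterate of x, where rho = (e / 2) eps is slightly larger than eps.  Let
k_l be the number of critical points of P in W_l.  Critical points act in two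
opposite ways:
- they make P fold, but by Rolle a value has at most k_l + 1 preimages in W_l
  ([size_fibre]);
- they make P contract, since a polynomial with k roots on a short interval is
  small there: |P'| <= C |W_l| ^ k_l on W_l ([deriv_le_crit]), and
  |W_l| <= e eps = exp (1 - L) with L = |ln eps|.

Take an (n, delta)-separated set in the dynamical ball of x, list it in
increasing order, and look at the gaps between neighbours.  Every gap has a
first time i < n at which its image has a point delta away from the image of its
left end; as delta <= rho - eps, before time i the whole gap follows the windows
W_l ([gap_escape]).  The gaps with a given i can be counted in two ways:
- the image of each of them at time i crosses a point of a fixed grid of mesh
  delta / 2, so there are at most (grid size) * prod_(l < i) (k_l + 1) of them
  ([fibre_bound], [count_hit_gaps]);
- each of them is stretched to size delta by a map of Lipschitz constant
  prod_(l < i) C |W_l| ^ k_l and their total length is at most 1, so there are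
  at most delta^-1 * prod_(l < i) C |W_l| ^ k_l of them
  ([orbit_lipschitz], [count_long_gaps]).

Here C may be enlarged to be at least 1, so that D = log^+ C equals ln C.  With
S = sum_(l < i) k_l, the first product is at most exp S and the second one at
most exp (i D - S (L - 1)).  The two exponents cross at S = i D / L, where both
equal i D / L; when L <= 1 the trivial bound exp (i D) <= exp (i D / L) suffices
([trade_off]).  Hence separated sets have at
most 1 + n G exp (n D / L) points, with G depending on delta only, and D / L
bounds the exponential growth rate. *)

(** * Critical points of a polynomial on an interval *)

Section CriticalPoints.
Context {R : rcfType}.
Implicit Types (p q : {poly R}) (a b x y g M : R) (s t : seq R).

Lemma mem_itv_between a b u v x :
  u \in `[a, b] -> v \in `[a, b] -> x \in `]u, v[ -> x \in `[a, b].
Proof. by rewrite !in_itv /= => uI vI xI; lra. Qed.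

Lemma rolle_path p x s :
    path <%R x s -> root p x -> all (root p) s ->
  exists t, [/\ path <%R x t, size t = size s, all (<= last x s) t
              & all (root p^`()) t].
Proof.
elim: s x => [|y s IH] x /=; first by exists [::].
move=> /andP[xy ys] px /andP[py ps].
have [t [yt szt tl pt]] := IH y ys py ps.
have [|c /itvP cI pc0] := @poly_rolle R x y p xy.
  by rewrite (rootP px) (rootP py).
have lastE : y <= last y s.
  case: s ys {IH ps szt tl} => //= z s /andP[yz /(order_path_min lt_trans)].
  move=> /allP zs; have := mem_last z s; rewrite inE => /orP[/eqP ->|/zs zl].
    exact: ltW.
  exact/ltW/(lt_trans yz).
exists (c :: t); split => /=.
- rewrite cI /=; apply: (path_le lt_trans) yt; rewrite ?cI//.
- by rewrite szt.
- by rewrite tl andbT (le_trans _ lastE) // cI.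
- by rewrite pt andbT; apply/rootP.
Qed.

(** Distinct roots are handled as strictly increasing lists, so that Rolle's
theorem between neighbours produces a list of the same kind, one shorter, and
can be iterated along the derivatives. *)
Lemma rolle_sorted p a b s :
    sorted <%R s -> all (mem `[a, b]) s -> all (root p) s ->
  exists t, [/\ sorted <%R t, size t = (size s).-1, all (mem `[a, b]) t
              & all (root p^`()) t].
Proof.
case: s => [|x s] /=; first by exists [::].
move=> xs /andP[xI sI] /andP[px ps].
have [t [xt szt tl pt]] := rolle_path p x s xs px ps.
exists t; split=> //; first exact: path_sorted xt.
have lb : last x s <= b.
  have := mem_last x s; rewrite inE => /orP[/eqP ->|].
    by rewrite (itvP xI).
  by move=> /(allP sI) /itvP ->.
apply/allP => z zt; rewrite inE in_itv/=.
have /allP/(_ z zt) xz := order_path_min lt_trans xt.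
have zl := allP tl z zt.
by rewrite (le_trans zl lb) andbT (le_trans _ (ltW xz)) // (itvP xI).
Qed.

Definition roots_itv p a b := [seq z <- rootsR p | z \in `[a, b]].

(** Critical points are counted without multiplicity. *)
Definition crit p a b := size (roots_itv p^`() a b).

Lemma mem_roots_itv p a b x :
  p != 0 -> (x \in roots_itv p a b) = (x \in `[a, b]) && root p x.
Proof.
move=> p0; rewrite mem_filter; congr (_ && _).
by rewrite -(roots_on_rootsR p0) in_itv.
Qed.

Lemma sorted_roots_itv p a b : sorted <%R (roots_itv p a b).
Proof. exact: (sorted_filter lt_trans _ (sorted_roots _ _ _)). Qed.

Lemma roots_itv_all p a b : all (mem `[a, b]) (roots_itv p a b).
Proof. exact: filter_all. Qed.

Lemma roots_itv_root p a b : p != 0 -> all (root p) (roots_itv p a b).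
Proof.
by move=> p0; apply/allP => x; rewrite mem_roots_itv // => /andP[].
Qed.

(** By Rolle, a critical point lies between any two consecutive solutions of
p = g. *)
Lemma size_fibre p a b g :
  p^`() != 0 -> (size (roots_itv (p - g%:P) a b) <= (crit p a b).+1)%N.
Proof.
move=> dp0.
have dE : (p - g%:P)^`() = p^`() by rewrite derivB derivC subr0.
have p0 : p - g%:P != 0.
  by apply: contraNneq dp0 => pg; rewrite -dE pg deriv0.
have [t [st szt tI pt]] := rolle_sorted (p - g%:P) a b _
  (sorted_roots_itv _ a b) (roots_itv_all _ _ _) (roots_itv_root _ a b p0).
rewrite (leq_trans (leqSpred _)) // ltnS -szt.
apply: uniq_leq_size; first exact: lt_sorted_uniq st.
move=> x xt; rewrite mem_roots_itv //; apply/andP; split; first exact: (allP tI).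
by rewrite -dE; apply: (allP pt).
Qed.

(** The point is that q vanishes somewhere in [a, b], so the mean value theorem
bounds q by b - a times a bound of its derivative; the derivative has one root
fewer, which allows induction on the number of roots. *)
Lemma poly_le_prod q a b k s M :
    sorted <%R s -> size s = k -> all (mem `[a, b]) s -> all (root q) s ->
    (forall x, x \in `[a, b] -> `|q^`(k).[x]| <= M) ->
  forall x, x \in `[a, b] -> `|q.[x]| <= M * (b - a) ^+ k.
Proof.
elim: k q s => [|k IH] q s ss szs sI qs qM x xI.
  by rewrite expr0 mulr1; apply: (qM x xI).
have [t [st szt tI qt]] := rolle_sorted q a b s ss sI qs.
have dqM : forall y, y \in `[a, b] -> `|q^`().[y]| <= M * (b - a) ^+ k.
  apply: (IH _ t) => //; first by rewrite szt szs.
  by move=> y yI; rewrite -derivSn; apply: qM.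
case: s szs sI qs {ss szt} => // c s _ /andP[cI _] /andP[/rootP qc _].
have -> : `|q.[x]| = `|q.[x] - q.[c]| by rewrite qc subr0.
have ba0 : 0 <= b - a by move: xI; rewrite in_itv /= => ?; lra.
have key : forall u v, u \in `[a, b] -> v \in `[a, b] -> u < v ->
    `|q.[v] - q.[u]| <= M * (b - a) ^+ k.+1.
  move=> u v uI vI uv; have [z zI ->] := poly_mvt q uv.
  rewrite normrM exprSr mulrA ler_pM // ?dqM //.
    exact: mem_itv_between zI.
  by rewrite gtr0_norm ?subr_gt0 // lerB ?(itvP uI) ?(itvP vI).
have [xc|cx|->] := ltgtP x c; [|exact: key|].
  by rewrite distrC; apply: key.
rewrite subrr normr0 exprSr mulrA mulr_ge0 //.
by apply: le_trans (dqM c cI); apply: normr_ge0.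
Qed.

(** The estimate needs the derivative of p of order [crit p a b + 1]; this order
is at most the degree of p, because p^`() has at most deg p - 1 roots. *)
Lemma deriv_le_crit p a b M :
    p^`() != 0 ->
    (forall k x, (0 < k < size p)%N -> x \in `[a, b] -> `|p^`(k).[x]| <= M) ->
  forall x, x \in `[a, b] -> `|p^`().[x]| <= M * (b - a) ^+ crit p a b.
Proof.
move=> dp0 pM; apply: (poly_le_prod _ _ _ _ (roots_itv p^`() a b)).
- exact: sorted_roots_itv.
- by [].
- exact: roots_itv_all.
- exact: roots_itv_root.
move=> x xI; rewrite -derivSn; apply: pM => //=.
have p0 : p != 0 by apply: contraNneq dp0 => ->; rewrite deriv0.
apply: leq_ltn_trans (lt_size_deriv p0).
have : (size (roots_itv p^`() a b) < size p^`())%N.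
  apply: max_poly_roots => //; first exact: roots_itv_root.
  exact: lt_sorted_uniq (sorted_roots_itv _ _ _).
by [].
Qed.

Lemma poly_lipschitz_itv p a b M u v :
    (forall x, x \in `[a, b] -> `|p^`().[x]| <= M) ->
    u \in `[a, b] -> v \in `[a, b] ->
  `|p.[u] - p.[v]| <= M * `|u - v|.
Proof.
move=> pM; wlog uv : u v / u < v => [hw uI vI|uI vI].
  have [uv|vu|->] := ltgtP u v; [exact: hw| |].
    by rewrite distrC (distrC u); apply: hw.
  by rewrite !subrr normr0 mulr0.
have [z zI e] := poly_mvt p uv.
rewrite distrC e normrM (distrC u) ler_wpM2r // pM //.
exact: mem_itv_between zI.
Qed.

End CriticalPoints.

(** * Counting gaps of an increasing sequence *)

Section Counting.
Context {R : realFieldType}.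
Implicit Types (s t : seq R) (a : pred nat).

(** The gaps are disjoint subintervals of [0, 1]; a gap is named by the index of
its left end. *)
Lemma count_long_gaps s a (c : R) :
    sorted <%R s -> all (mem `[0, 1]) s ->
    (forall j, (j < (size s).-1)%N -> a j -> c <= s`_j.+1 - s`_j) ->
  (count a (iota 0 (size s).-1))%:R * c <= 1.
Proof.
move=> ss sI sc; set N := (size s).-1.
have [N0|N0] := posnP N; first by rewrite N0 /= mul0r.
have szN : size s = N.+1 by rewrite /N prednK //; case: (size s) @N N0.
have nthI j : (j <= N)%N -> 0 <= s`_j <= 1.
  move=> jN; have /(allP sI) : s`_j \in s by rewrite mem_nth // szN.
  by rewrite inE in_itv.
have telescope : \sum_(0 <= j < N) (s`_j.+1 - s`_j) <= 1.
  rewrite telescope_sumr //; have := nthI 0 isT; have := nthI N (leqnn N).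
  by move=> *; lra.
apply: le_trans telescope.
rewrite -size_filter -sum1_size natr_sum mulr_suml big_filter.
rewrite /index_iota subn0 big_mkcond /= big_seq [leRHS]big_seq.
apply: ler_sum => j; rewrite mem_iota /= add0n => jN.
case: ifP => aj; first by rewrite mul1r sc.
rewrite subr_ge0 ltW // (sorted_ltn_nth lt_trans) // inE szN //.
exact: leqW.
Qed.

(** Distinct open gaps contain distinct points, hence there are no more gaps of
the given kind than points available to hit them. *)
Lemma count_hit_gaps s a t :
    sorted <%R s ->
    (forall j, (j < (size s).-1)%N -> a j ->
      exists2 y, y \in t & s`_j < y < s`_j.+1) ->
  (count a (iota 0 (size s).-1) <= size t)%N.
Proof.
move=> ss hit; rewrite -size_filter.
have /choice[y yP] : forall j, exists y, (j < (size s).-1)%N -> a j ->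
    y \in t /\ s`_j < y < s`_j.+1.
  move=> j.
  have [jN|jN] := ltnP j (size s).-1; last by exists 0.
  have [aj|aj] := boolP (a j); last by exists 0.
  by have [y yt yI] := hit j jN aj; exists y.
rewrite -(size_map y); apply: uniq_leq_size.
  have nth_le i j : (i <= j)%N -> (j < size s)%N -> s`_i <= s`_j.
    move=> ij jN; have /orP[/eqP ->//|lt] : (i == j) || (i < j)%N.
      by rewrite -leq_eqVlt.
    by rewrite ltW // (sorted_ltn_nth lt_trans) // inE // (leq_ltn_trans ij).
  have y_lt i j : (j < (size s).-1)%N -> a i -> a j -> (i < j)%N -> y i < y j.
    move=> jN ai aj ij; have [_ /andP[_ yi]] := yP i (ltn_trans ij jN) ai.
    have [_ /andP[yj _]] := yP j jN aj.
    apply: lt_le_trans yi (le_trans _ (ltW yj)); apply: nth_le => //.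
    exact: leq_trans jN (leq_pred _).
  rewrite map_inj_in_uniq ?filter_uniq ?iota_uniq // => i j.
  rewrite !mem_filter !mem_iota /= !add0n => /andP[ai iN] /andP[aj jN] e.
  have [lt|lt|//] := ltngtP i j.
    by have := y_lt i j jN ai aj lt; rewrite e ltxx.
  by have := y_lt j i iN aj ai lt; rewrite e ltxx.
move=> z /mapP[j]; rewrite mem_filter mem_iota /= add0n => /andP[aj jN] ->.
by have [] := yP j jN aj.
Qed.

Lemma sum_count_labels (lab : nat -> nat) n (s : seq nat) :
    (forall j, j \in s -> (lab j < n)%N) ->
  (\sum_(i < n) count (fun j => lab j == i) s = size s)%N.
Proof.
elim: s => [|j s IH] lt_n /=; first by rewrite big1.
rewrite big_split /= IH => [|k ks]; last by rewrite lt_n // inE ks orbT.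
rewrite -add1n; congr (_ + _)%N; have jn : (lab j < n)%N by rewrite lt_n // inE eqxx.
rewrite (bigD1 (Ordinal jn)) //= eqxx big1 ?addn0 // => i.
by rewrite eq_sym -val_eqE /= => /negPf ->.
Qed.

End Counting.

(** * Orbits following a sequence of windows *)

Section Orbits.
Context {R : rcfType}.
Implicit Types (p : {poly R}) (a b M : nat -> R) (u v x y g : R) (n i l : nat).

Local Notation orbit p i x := (iter i (fun z => p.[z]) x).

(** Time i itself is left out: the windows control the i applications of p that
lead to the i-th iterate. *)
Definition stays p a b i x := forall l, (l < i)%N -> orbit p l x \in `[a l, b l].

Lemma stays_le p a b i l x : (l <= i)%N -> stays p a b i x -> stays p a b l x.
Proof. by move=> li sx k kl; apply: sx; apply: leq_trans li. Qed.

(** A point following the windows is found by solving p = g once in each of them,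
backwards in time from g; each step has at most one more solution than the
window has critical points. *)
Lemma fibre_bound p a b i g :
    p^`() != 0 ->
  exists2 t : seq R, (size t <= \prod_(l < i) (crit p (a l) (b l)).+1)%N
    & forall y, stays p a b i y -> orbit p i y = g -> y \in t.
Proof.
move=> dp0; elim: i g => [|i IH] g.
  by exists [:: g] => [|y _ /= ->]; rewrite ?big_ord0 ?inE.
have /choice[t tP] : forall h, exists t : seq R,
    (size t <= \prod_(l < i) (crit p (a l) (b l)).+1)%N
    /\ forall y, stays p a b i y -> orbit p i y = h -> y \in t.
  by move=> h; have [t] := IH h; exists t.
exists (flatten [seq t h | h <- roots_itv (p - g%:P) (a i) (b i)]).
  rewrite size_flatten /shape -map_comp big_ord_recr /= mulnC.
  apply: leq_trans (leq_mul (size_fibre p (a i) (b i) g dp0) (leqnn _)).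
  elim: (roots_itv _ _ _) => //= h s IHs; rewrite mulSn leq_add //.
  by have [] := tP h.
move=> y sy gy; apply/flattenP; exists (t (orbit p i y)).
  apply: map_f; rewrite mem_roots_itv; last first.
    apply: contraNneq dp0 => pg.
    by have := derivC g; rewrite -(subrK g%:P p) pg add0r => ->.
  by rewrite sy //= rootE !hornerE -gy subrr.
have [_] := tP (orbit p i y); apply=> //.
exact: stays_le (leqnSn i) sy.
Qed.

Lemma orbit_lipschitz p a b M i u v :
    (forall l, (l < i)%N -> 0 <= M l) ->
    (forall l x, (l < i)%N -> x \in `[a l, b l] -> `|p^`().[x]| <= M l) ->
    stays p a b i u -> stays p a b i v ->
  `|orbit p i u - orbit p i v| <= \prod_(l < i) M l * `|u - v|.
Proof.
elim: i => [|i IH] M0 pM su sv; first by rewrite big_ord0 mul1r.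
have := poly_lipschitz_itv p (a i) (b i) (M i) (orbit p i u) (orbit p i v).
move=> /(_ (fun x => pM i x (ltnSn i)) (su i (ltnSn i)) (sv i (ltnSn i))).
move=> /le_trans; apply; rewrite big_ord_recr /= (mulrC _ (M i)) -mulrA.
rewrite ler_wpM2l ?M0 //; apply: IH => [l li|l x li||].
- by rewrite M0 // ltnW.
- by apply: pM; rewrite ltnW.
- exact: stays_le (leqnSn i) su.
- exact: stays_le (leqnSn i) sv.
Qed.

(** Strict inequalities on g yield a preimage in the open interval, so preimages
found in adjacent gaps are distinct. *)
Lemma orbit_ivt p i u v g :
    u <= v ->
    Num.min (orbit p i u) (orbit p i v) < g < Num.max (orbit p i u) (orbit p i v) ->
  exists2 y, u < y < v & orbit p i y = g.
Proof.
(* The i-th iterate is itself a polynomial function. *)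
pose q := iter i (fun r => p \Po r) 'X.
have qE x : q.[x] = orbit p i x.
  rewrite /q; elim: i {q} x => [|i IH] x /=; first by rewrite hornerX.
  by rewrite horner_comp IH.
rewrite -!qE => uv.
have inner y : root (q - g%:P) y -> u <= y <= v -> q.[u] != g -> q.[v] != g ->
    exists2 y, u < y < v & orbit p i y = g.
  rewrite rootE !hornerE subr_eq0 => /eqP yg /andP[uy yv] ug vg.
  exists y; last by rewrite -qE.
  rewrite !lt_neqAle uy yv !andbT; apply/andP; split.
    by apply: contraNneq ug => ->; rewrite yg.
  by apply: contraNneq vg => <-; rewrite yg.
have [_|_] := leP q.[u] q.[v] => /andP[g1 g2].
  have [|y yI yr] := @poly_ivt _ (q - g%:P) u v uv.
    by rewrite !hornerE; apply/andP; split; lra.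
  by apply: inner yr yI _ _; rewrite ?(lt_eqF g1) ?(gt_eqF g2).
have [|y yI] := @poly_ivt _ (- (q - g%:P)) u v uv.
  by rewrite !hornerE; apply/andP; split; lra.
rewrite rootN => yr.
by apply: inner yr yI _ _; rewrite ?(lt_eqF g1) ?(gt_eqF g2).
Qed.

End Orbits.

(** * Separated sets, spanning numbers and their growth *)

Section Separation.
Context {R : realType}.
Implicit Types (f : R -> R) (s : seq R) (L : set R) (n : nat).

Definition orbit_separated f n (delta : R) s :=
  uniq s /\ forall u v, u \in s -> v \in s -> u != v ->
    exists2 i, (i < n)%N & delta <= `|iter i f u - iter i f v|.

(** A separated set of maximal cardinality is spanning: a point far from all its
elements could be added to it. *)
Lemma span_number_le_separated f n L (delta B : R) :
    0 < delta -> (L `<=` unit_interval)%classic ->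
    (forall s, {in s, forall y, L y} -> orbit_separated f n delta s ->
      (size s)%:R <= B) ->
  (span_number f n L delta <= B%:E)%E.
Proof.
move=> d0 LI sB.
pose P m := `[< exists s, [/\ {in s, forall y, L y}, orbit_separated f n delta s
                            & size s = m] >].
have P0 : exists m, P m by exists 0; apply/asboolP; exists [::].
have Pm m : P m -> (m <= Num.truncn B)%N.
  move=> /asboolP[s [sL ss <-]]; have sizeB := sB s sL ss.
  by rewrite truncn_ge_nat // (le_trans _ sizeB).
case: (ex_maxnP P0 Pm) => m /asboolP[s [sL ss szs]] smax.
apply: (@le_trans _ _ ((#|` [fset z in s]%fset|)%:R%:E)); last first.
  by rewrite lee_fin card_fseq undup_id ?sB // (proj1 ss).
apply: ereal_inf_lbound; exists [fset z in s]%fset => //; split.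
  by move=> y /=; rewrite inE => /sL /LI.
move=> x Lx; apply: contrapT => nox.
have xs : x \notin s.
  apply/negP => xs; apply: nox; exists x; first by rewrite inE.
  by move=> i _; rewrite subrr normr0.
have far y : y \in s -> exists2 i, (i < n)%N & delta <= `|iter i f x - iter i f y|.
  move=> ys; apply: contrapT => close; apply: nox; exists y; first by rewrite inE.
  move=> i i_n; rewrite ltNge; apply/negP => ge; apply: close; by exists i.
have : P m.+1.
  apply/asboolP; exists (x :: s); split; last by rewrite /= szs.
    by move=> y; rewrite inE => /predU1P[->//|/sL].
  split; first by rewrite /= xs (proj1 ss).
  move=> u v; rewrite !inE => /predU1P[->|us] /predU1P[->|vs] uv.
  - by rewrite eqxx in uv.
  - exact: far.
  - by have [j jn d] := far u us; exists j => //; rewrite distrC.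
  - exact: (proj2 ss).
by move=> /smax; rewrite ltnn.
Qed.

Lemma le_span_number f n L (delta delta' : R) : delta <= delta' ->
  (span_number f n L delta' <= span_number f n L delta)%E.
Proof.
move=> dd; apply: ereal_inf_le_tmp => _ /= [K [KI Ksp] <-]; exists K => //.
split=> // x /Ksp [y yK xy]; exists y => // i i_n.
exact: lt_le_trans (xy i i_n) dd.
Qed.

Lemma le_lne (x y : \bar R) : (x <= y)%E -> (lne x <= lne y)%E.
Proof.
move=> xy; have [x0|x0] := leP x 0%E; first by rewrite le0_lneNy // leNye.
by rewrite lee_lne // in_itv /= leey andbT ltW // (lt_le_trans x0).
Qed.

Lemma limn_esup_le (u : (\bar R)^nat) N (c : \bar R) :
  (forall n, (N <= n)%N -> (u n <= c)%E) -> (limn_esup u <= c)%E.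
Proof.
move=> uc; apply: ereal_inf_le; exists (ereal_sup [set u n | n in [set n | (N <= n)%N]])%classic.
  by exists [set n | (N <= n)%N]%classic => //; exists N.
by apply: ge_ereal_sup => _ [n Nn <-]; apply: uc.
Qed.

Lemma le_limn_esup (u v : (\bar R)^nat) :
  (forall n, (u n <= v n)%E) -> (limn_esup u <= limn_esup v)%E.
Proof.
move=> uv; rewrite !limn_esup_lim; apply: lee_lim; try exact: is_cvg_esups.
apply: nearW => n; apply: ge_ereal_sup => _ [k nk <-].
by apply: le_trans (uv k) _; apply: ereal_sup_ubound; exists k.
Qed.

Lemma le_tail_growth f (eps delta delta' : R) : delta <= delta' ->
  (tail_growth f eps delta' <= tail_growth f eps delta)%E.
Proof.
move=> dd; apply: le_limn_esup => n; apply: lee_wpmul2l.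
  by rewrite lee_fin invr_ge0.
apply: le_lne; apply: ge_ereal_sup => _ [x xI <-].
apply: le_trans (le_span_number _ _ _ _ _ dd) _.
by apply: ereal_sup_ubound; exists x.
Qed.

(** The prefactor is absorbed by any e > 0, since
n G <= (n e)^2 / 2 <= exp (n e) - 1 for n >= 2 G / e^2. *)
Lemma tail_growth_le f (eps delta h G : R) :
    0 <= G ->
    (forall n x, unit_interval x ->
      (span_number f n (dyn_ball f n x eps) delta
       <= (1 + n%:R * G * expR (n%:R * h))%:E)%E) ->
  0 <= h -> (tail_growth f eps delta <= h%:E)%E.
Proof.
move=> G0 spanG h0; apply/lee_addgt0Pr => e e0.
pose N := (Num.truncn (2 * G / e ^+ 2)).+1.
apply: (limn_esup_le _ N) => n Nn.
have n0 : 0 < n%:R :> R by rewrite ltr0n; apply: leq_trans Nn.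
have Gn : n%:R * G <= (n%:R * e) ^+ 2 / 2.
  have : 2 * G / e ^+ 2 <= n%:R.
    by apply/ltW/(lt_le_trans (truncnS_gt _)); rewrite ler_nat.
  rewrite ler_pdivrMr ?exprn_gt0 // => /(ler_wpM2l (ltW n0)).
  by rewrite exprMn => ?; nra.
have Gexp : 1 + n%:R * G * expR (n%:R * h) <= expR (n%:R * (h + e)).
  have h1 : 1 <= expR (n%:R * h) by rewrite -expR0 ler_expR mulr_ge0 // ltW.
  have := @expR_ge1Dxn _ (n%:R * e) 1 (mulr_ge0 (ltW n0) (ltW e0)).
  rewrite mulrDr expRD (_ : 2`! = 2)%N // => eN.
  have := mulr_ge0 (ltW n0) G0; nra.
rewrite -(@lee_pmul2l _ n%:R%:E) ?lte_fin // muleA -EFinM divff ?gt_eqF // mul1e.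
apply: (@le_trans _ _ (lne (expR (n%:R * (h + e)))%:E)).
  apply: le_lne; apply: ge_ereal_sup => _ [x xI <-].
  by apply: le_trans (spanG n x xI) _; rewrite lee_fin.
by rewrite lne_EFin ?expR_gt0 // expRK.
Qed.

(** The limit exists because [tail_growth] increases as delta decreases. *)
Lemma tail_entropy_le f (eps delta0 c : R) :
    0 < delta0 ->
    (forall delta, 0 < delta < delta0 -> (tail_growth f eps delta <= c%:E)%E) ->
  (tail_entropy f eps <= c%:E)%E.
Proof.
move=> d0 growth; apply: lime_le.
  apply: nonincreasing_at_right_is_cvge; apply: nearW => x u v _ _.
  exact: le_tail_growth.
near=> delta; apply: growth; apply/andP; split; near: delta.
  exact: nbhs_right_gt.
exact: nbhs_right_lt.
Unshelve. all: by end_near. Qed.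

End Separation.

(** * Folding against contraction *)

Section TradeOff.
Context {R : realType}.

(** N is bounded both by the folding and by the contraction.  The first bound is
used when the total number S of critical points is at most i D / L, with
D = ln C: its product is at most exp S because k + 1 <= exp k.  In the other case the second product
C ^ i * w ^ S is at most exp (i D - S (L - 1)), which decreases in S when L > 1;
when L <= 1, w <= 1 is enough. *)
Lemma trade_off i (k : nat -> nat) (N G C w L : R) :
    1 <= C -> 0 <= w <= 1 -> w <= expR (1 - L) -> 0 < L -> 0 <= G ->
    N <= G * \prod_(l < i) (k l).+1%:R ->
    N <= G * \prod_(l < i) (C * w ^+ k l) ->
  N <= G * expR (i%:R * (ln C / L)).
Proof.
move=> C1 /andP[w0 w1] wL L0 G0 Nk Nw; set D := ln C.
have D0 : 0 <= D by rewrite ln_ge0.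
have CE : C = expR D by rewrite lnK // posrE (lt_le_trans ltr01).
pose S := (\sum_(l < i) k l)%N.
have prodE : \prod_(l < i) (C * w ^+ k l) = C ^+ i * w ^+ S.
  by rewrite big_split /= prodr_const card_ord prodrXr.
have [SD|SD] := leP (S%:R) (i%:R * (D / L)).
  apply: le_trans Nk _; rewrite ler_wpM2l //.
  apply: (@le_trans _ _ (expR S%:R)); last by rewrite ler_expR.
  rewrite natr_sum expR_sum; apply: ler_prod => l _.
  by rewrite ler0n -addn1 natrD addrC expR_ge1Dx.
apply: le_trans Nw _; rewrite ler_wpM2l // prodE CE -expRM_natl.
have [L1|L1] := leP L 1.
  apply: (@le_trans _ _ (expR (i%:R * D))).
    by rewrite ler_piMr ?expR_ge0 // exprn_ile1.
  by rewrite ler_expR ler_wpM2l // ler_pdivlMr // ler_piMr.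
apply: (@le_trans _ _ (expR (i%:R * D) * expR (S%:R * (1 - L)))).
  by rewrite ler_wpM2l ?expR_ge0 // expRM_natl lerXn2r // nnegrE ?expR_ge0.
rewrite -expRD ler_expR.
have -> : i%:R * (D / L) = i%:R * D + i%:R * (D / L) * (1 - L).
  by field; rewrite gt_eqF.
by rewrite lerD2l; apply: ler_wnM2r; [lra|exact: ltW].
Qed.

Lemma grid_between (delta x y : R) :
    0 < delta -> 0 <= x -> x + delta <= y -> y <= 1 ->
  exists2 m, (m < (Num.truncn (2 / delta)).+1)%N & x < m%:R * (delta / 2) < y.
Proof.
move=> d0 x0 xy y1; set q := Num.truncn (2 * x / delta).
have d2 : 0 < delta / 2 by lra.
have q_gt : 2 * x < q.+1%:R * delta.
  by rewrite -ltr_pdivrMr //; apply: truncnS_gt.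
have q_le : q%:R * delta <= 2 * x.
  by rewrite -ler_pdivlMr // truncn_le divr_ge0 ?mulr_ge0 // ltW.
move: q_gt; rewrite -[q.+1]addn1 natrD => q_gt.
exists q.+1; last by rewrite -addn1 natrD; lra.
rewrite ltnS truncn_ge_nat ?divr_ge0 ?(ltW d0) // ler_pdivlMr //.
by rewrite -addn1 natrD; lra.
Qed.

End TradeOff.

(** * Separated sets inside a dynamical ball *)

Section Gaps.
Context {R : realType}.
Implicit Types (p : {poly R}) (x y u v eps rho delta : R) (n i l : nat).
Implicit Types (s : seq R).

Local Notation orbit p i x := (iter i (fun z => p.[z]) x).

(** The windows are cut down to [0, 1] because the derivatives of p are only
bounded there. *)
Definition win_lo p x rho l := Num.max 0 (orbit p l x - rho).
Definition win_hi p x rho l := Num.min 1 (orbit p l x + rho).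

Lemma orbit_itv p i x :
  unit_self_map (fun z => p.[z]) -> unit_interval x -> 0 <= orbit p i x <= 1.
Proof.
move=> pI xI; have : unit_interval (orbit p i x) by elim: i => //= i /pI.
by rewrite /unit_interval /= in_itv.
Qed.

(** The escape time i is the first one at which the gap is stretched to size
delta.  Before it, the images of the gap stay within delta of the image of u,
hence within eps + delta <= rho of the orbit of x.  In particular the gap need
not lie inside the dynamical ball. *)
Lemma gap_escape p n x eps rho delta u v :
    unit_self_map (fun z => p.[z]) -> delta <= rho - eps ->
    dyn_ball (fun z => p.[z]) n x eps u -> dyn_ball (fun z => p.[z]) n x eps v ->
    u < v ->
    (exists2 i, (i < n)%N & delta <= `|orbit p i u - orbit p i v|) ->
  exists i w, [/\ (i < n)%N, u <= w <= v, delta <= `|orbit p i w - orbit p i u|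
    & forall z, u <= z <= v -> stays p (win_lo p x rho) (win_hi p x rho) i z].
Proof.
move=> pI drho [uI ux] [vI vx] uv [i0 i0n far0].
pose P i := `[< exists2 w, u <= w <= v & delta <= `|orbit p i w - orbit p i u| >].
have P0 : exists i, P i.
  by exists i0; apply/asboolP; exists v; rewrite ?(ltW uv) ?lexx // distrC.
case: (ex_minnP P0) => i /asboolP[w wI far] imin.
have i_n : (i < n)%N.
  apply: leq_ltn_trans i0n; apply: imin; apply/asboolP.
  by exists v; rewrite ?(ltW uv) ?lexx // distrC.
exists i, w; split=> // z zI l li.
have near : `|orbit p l z - orbit p l u| < delta.
  rewrite ltNge; apply/negP => ge; move: li; rewrite ltnNge imin //.
  by apply/asboolP; exists z.
have z01 : unit_interval z.
  move: uI vI; rewrite /unit_interval /= !in_itv /= => uI vI; lra.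
have /andP[f0 f1] := orbit_itv p l z pI z01.
have := ux l (ltn_trans li i_n).
move: near; rewrite !ltr_norml => /andP[? ?] /andP[? ?].
rewrite in_itv /= ge_max le_min f0 f1 /=; lra.
Qed.

(** The bound is the sum over the escape times i < n of the number of gaps
escaping at time i, each of which is controlled by [trade_off]. *)
Lemma separated_size p n x eps rho delta C s :
    p^`() != 0 -> unit_self_map (fun z => p.[z]) -> 1 <= C ->
    (forall k y, (0 < k < size p)%N -> unit_interval y -> `|p^`(k).[y]| <= C) ->
    unit_interval x -> 0 < eps < 1 -> 0 < delta <= rho - eps ->
    2 * rho <= expR (1 - `|ln eps|) ->
    {in s, forall y, dyn_ball (fun z : R => p.[z]) n x eps y} ->
    orbit_separated (fun z => p.[z]) n delta s ->
  (size s)%:R <= 1 + n%:R * (Num.truncn (2 / delta)).+1%:R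
                     * expR (n%:R * (ln C / `|ln eps|)).
Proof.
move=> dp0 pI C1 pC xI /andP[eps0 eps1] /andP[delta0 drho] rho_le sB sep.
wlog ss : s sB sep / sorted <%R s => [hw|].
  rewrite -(size_sort <=%R); apply: hw.
  - by move=> y; rewrite mem_sort; apply: sB.
  - split; first by rewrite sort_uniq (proj1 sep).
    by move=> u v; rewrite !mem_sort; apply: (proj2 sep).
  - by rewrite sort_lt_sorted (proj1 sep).
set L := `|ln eps|; set h := ln C / L; set G := (Num.truncn _).+1.
have L0 : 0 < L by rewrite normr_gt0 lt_eqF // ln_lt0 // eps0.
have h0 : 0 <= h by rewrite divr_ge0 ?ln_ge0 // ltW.
pose lo := win_lo p x rho; pose hi := win_hi p x rho.
pose w := Num.min 1 (2 * rho).
have w0 : 0 < w by rewrite lt_min ltr01 /=; lra.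
have w1 : w <= 1 by rewrite ge_min lexx.
pose k l := crit p (lo l) (hi l).
pose M l := C * w ^+ k l.
(* M l is the contraction bound: it dominates the derivative on the window,
   whose length is at most w. *)
have M0 l : 0 < M l by rewrite mulr_gt0 ?exprn_gt0 // (lt_le_trans ltr01).
have pM l y : y \in `[lo l, hi l] -> `|p^`().[y]| <= M l.
  move=> yI; apply: le_trans (deriv_le_crit p (lo l) (hi l) C dp0 _ y yI) _.
    move=> j z jp; rewrite in_itv /= /lo /hi /win_lo /win_hi ge_max le_min.
    move=> zI; apply: pC => //; rewrite /unit_interval /= in_itv /=; lra.
  rewrite ler_wpM2l ?(le_trans ler01) // lerXn2r ?nnegrE ?(ltW w0) //.
    by move: yI; rewrite in_itv /= => ?; lra.
  have : hi l <= 1 /\ hi l <= orbit p l x + rho.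
    by split; rewrite ge_min lexx ?orbT.
  have : 0 <= lo l /\ orbit p l x - rho <= lo l.
    by split; rewrite le_max lexx ?orbT.
  by rewrite le_min => -[? ?] [? ?]; lra.
have s_mem j : (j < size s)%N -> s`_j \in s by move=> js; rewrite mem_nth.
(* lab j is the escape time of the gap between s`_j and s`_j.+1. *)
have /choice[lab labP] : forall j, exists i, (j < (size s).-1)%N ->
    (i < n)%N /\ exists z, [/\ s`_j <= z <= s`_j.+1,
      delta <= `|orbit p i z - orbit p i s`_j|
      & forall y, s`_j <= y <= s`_j.+1 -> stays p lo hi i y].
  move=> j; have [jN|jN] := ltnP j (size s).-1; last by exists 0.
  have js1 : (j.+1 < size s)%N by rewrite -ltn_predRL.
  have js : (j < size s)%N by exact: ltn_trans js1.
  have lt_s : s`_j < s`_j.+1 by rewrite (sorted_ltn_nth lt_trans).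
  have far := proj2 sep _ _ (s_mem _ js) (s_mem _ js1) (negbT (lt_eqF lt_s)).
  have [i [z [i_n zI zfar st]]] := gap_escape p n x eps rho delta _ _
    pI drho (sB _ (s_mem _ js)) (sB _ (s_mem _ js1)) lt_s far.
  by exists i => _; split=> //; exists z.
have s01 : all (mem `[0, 1]) s by apply/allP => y /sB [].
have s_itv j : (j < size s)%N -> 0 <= s`_j <= 1.
  by move=> /s_mem /sB []; rewrite /unit_interval /= in_itv.
pose N i := count (fun j => lab j == i) (iota 0 (size s).-1).
have N_le i : (i < n)%N -> (N i)%:R <= G%:R * expR (n%:R * h).
  move=> i_n; apply: (@le_trans _ _ (G%:R * expR (i%:R * h))); last first.
    by rewrite ler_wpM2l // ler_expR ler_wpM2r // ler_nat ltnW.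
  apply: (@trade_off _ i k _ _ C w) => //; first by rewrite w1 ltW.
  - by rewrite (le_trans _ rho_le) // /w ge_min lexx orbT.
  (* Folding: t m collects the preimages of the m-th grid point, and every gap
     of label i contains one of them. *)
  - have /choice[t tP] : forall m : nat, exists t : seq R,
        (size t <= \prod_(l < i) (k l).+1)%N /\
        forall y, stays p lo hi i y -> orbit p i y = m%:R * (delta / 2) -> y \in t.
      move=> m; have [t] := fibre_bound p lo hi i (m%:R * (delta / 2)) dp0.
      by exists t.
    rewrite -natr_prod -natrM ler_nat.
    apply: (@leq_trans (size (flatten [seq t m | m <- iota 0 G]))).
      apply: count_hit_gaps ss _ => j jN /eqP jlab.
      have [_ [z [zI zfar st]]] := labP j jN; rewrite jlab in zfar st.
      have grid := orbit_itv p i _ pI.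
      have fz : 0 <= orbit p i z <= 1.
        apply: grid; rewrite /unit_interval /= in_itv /=.
        have := s_itv j.+1; rewrite -ltn_predRL => /(_ jN).
        have := s_itv j (leq_trans jN (leq_pred _)); lra.
      have fs : 0 <= orbit p i s`_j <= 1.
        apply: grid; rewrite /unit_interval /= in_itv /=.
        exact: s_itv (leq_trans jN (leq_pred _)).
      have [m mG mI] : exists2 m, (m < G)%N &
          Num.min (orbit p i s`_j) (orbit p i z) < m%:R * (delta / 2)
          < Num.max (orbit p i s`_j) (orbit p i z).
        case: (leP (orbit p i s`_j) (orbit p i z)) zfar => le.
          by rewrite ger0_norm ?subr_ge0 // => ?; apply: grid_between; lra.
        by rewrite ltr0_norm ?subr_lt0 // => ?; apply: grid_between; lra.
      have /andP[sz zs] := zI.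
      have [y /andP[sy yz] fy] := orbit_ivt p i _ _ _ sz mI.
      have ys : s`_j <= y <= s`_j.+1 by rewrite ltW //= (le_trans (ltW yz)).
      exists y; last by rewrite sy (lt_le_trans yz).
      apply/flattenP; exists (t m); first by rewrite map_f // mem_iota.
      by apply: (proj2 (tP m)) fy; apply: st.
    rewrite size_flatten /shape -map_comp -[X in (_ <= X * _)%N](size_iota 0).
    elim: (iota 0 G) => //= m r IH; rewrite mulSn leq_add //.
    by have [] := tP m.
  (* Contraction: a gap of label i cannot be shorter than delta divided by the
     Lipschitz constant. *)
  have prod0 : 0 < \prod_(l < i) M l by rewrite prodr_gt0.
  have Nd : (N i)%:R * (delta / \prod_(l < i) M l) <= 1.
    apply: count_long_gaps ss s01 _ => j jN /eqP jlab.
    have [_ [z [/andP[sz zs] zfar st]]] := labP j jN; rewrite jlab in zfar st.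
    rewrite ler_pdivrMr // (le_trans zfar) // mulrC.
    apply: le_trans (orbit_lipschitz p lo hi M i z s`_j _ _ _ _) _.
    + by move=> l _; apply: ltW.
    + by move=> l y _; apply: pM.
    + by apply: st; rewrite sz.
    + by apply: st; rewrite lexx (le_trans sz).
    by rewrite ler_wpM2l ?(ltW prod0) // ger0_norm ?subr_ge0 // lerB.
  rewrite mulrA ler_pdivrMr // mul1r -ler_pdivlMr // in Nd.
  apply: le_trans Nd _; rewrite mulrC ler_wpM2r ?(ltW prod0) //.
  apply: le_trans (ltW (truncnS_gt _)).
  by rewrite -[leLHS]mul1r ler_wpM2r ?invr_ge0 ?(ltW delta0) // ler1n.
have [->|s_gt0] := posnP (size s).
  by rewrite addr_ge0 // mulr_ge0 ?expR_ge0 // mulr_ge0.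
rewrite -(prednK s_gt0) -addn1 natrD addrC lerD2l -mulrA.
rewrite -[X in X%:R <= _](size_iota 0) -(sum_count_labels lab n); last first.
  by move=> j; rewrite mem_iota add0n => /andP[_ /labP []].
rewrite natr_sum -[X in _ <= X%:R * _](card_ord n) -sumr_const mulr_suml.
by apply: ler_sum => i _; rewrite mul1r; apply: N_le.
Qed.

End Gaps.

(** * The entropy bound *)

Section Norms.
Context {R : realType}.
Implicit Types (p : {poly R}) (x : R).

Lemma le_sup_norm p x :
  unit_interval x -> `|p.[x]| <= sup_norm (fun z => p.[z]).
Proof.
move=> xI; apply: ub_le_sup; last by exists x.
have [B pB] := poly_itv_bound p 0 1; exists B => _ [z zI <-].
by apply: pB; move: zI; rewrite /unit_interval /= in_itv.
Qed.

Lemma le_Cr_norm r p k x :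
  (0 < k <= r)%N -> unit_interval x -> `|p^`(k).[x]| <= Cr_norm r p.
Proof.
move=> kr xI; apply: le_trans (le_sup_norm p^`(k) x xI) _.
apply: (le_bigmax_seq 0 k xpredT (fun k => sup_norm (fun z => p^`(k).[z]))) => //.
by rewrite mem_index_iota ltnS.
Qed.

(** This holds even for x <= 0, where ln takes the value 0. *)
Lemma log_plusE x : log_plus x = ln (Num.max 1 x).
Proof.
rewrite /log_plus; have [x1|x1] := leP 1 x.
  by rewrite max_l // ln_ge0.
rewrite ln1 max_r //; have [x0|x0] := leP x 0; first by rewrite ln0.
by rewrite ltW // ln_lt0 // x0.
Qed.

End Norms.

Theorem corollary6 (R : realType) (r : nat) (C : R)
  (r_gt0 : (0 < r)%N)
  (HC : forall Q : {poly R}, poly_self_map r Q -> Cr_norm r Q <= C)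
  (P : {poly R}) (HP : poly_self_map r P)
  (eps : R) (eps_gt0 : 0 < eps) (eps_lt1 : eps < 1) :
  (tail_entropy (fun x => P.[x]) eps <= (log_plus C / `|ln eps|)%:E)%E.
Proof.
have [szP PI] := HP; set K := Num.max 1 C.
have K1 : 1 <= K by rewrite le_max lexx.
have dP0 : P^`() != 0.
  have lead : P`_r != 0.
    have -> : P`_r = lead_coef P by rewrite lead_coefE szP.
    by rewrite lead_coef_eq0 -size_poly_eq0 szP.
  apply: contraNneq lead => dP0; have := coef_deriv P r.-1.
  by rewrite dP0 coef0 prednK // => /esym/eqP; rewrite mulrn_eq0 gtn_eqF.
have PK k y : (0 < k < size P)%N -> unit_interval y -> `|P^`(k).[y]| <= K.
  rewrite szP ltnS => kr yI; apply: le_trans (le_Cr_norm r P k y kr yI) _.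
  by rewrite le_max (HC P HP) orbT.
(* The factor e / 2 > 1 leaves room between eps and rho, and gives the windows
   a length of at most e * eps. *)
pose rho := expR 1 / 2 * eps.
have e2 : 2 < expR 1 :> R by have := @expR_gt1Dx R 1 (oner_neq0 _); lra.
have rho_gt : 0 < rho - eps by rewrite /rho; nra.
have rho_le : 2 * rho <= expR (1 - `|ln eps|).
  rewrite ltr0_norm ?ln_lt0 ?eps_gt0 // opprK expRD lnK ?posrE // /rho.
  by rewrite mulrA mulrCA divff ?mulr1.
rewrite log_plusE -/K; apply: (tail_entropy_le _ _ _ _ rho_gt).
move=> delta /andP[delta0 delta_lt].
apply: (tail_growth_le _ _ _ _ (Num.truncn (2 / delta)).+1%:R) => //; last first.
  by rewrite divr_ge0 ?ln_ge0.
move=> n x xI; apply: span_number_le_separated => // [y []//|s sB sep].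
apply: (separated_size P n x eps rho) => //; first by rewrite eps_gt0.
by rewrite delta0 ltW.
Qed.
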